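(* Let $m,p,q$ be integers with $1\le p,q\le m$, and let $\overline{A}\in\mathbb{C}^{m\times m}$, $\overline{B}\in\mathbb{C}^{m\times p}$, $C\in\mathbb{C}^{q\times m}$, $D\in\mathbb{C}^{q\times p}$. Let $\gamma$ be the largest singular value of $\overline{A}$ (so that $\gamma=\|\overline{A}\|$ and $\gamma\ge|\lambda_j|$ for all eigenvalues $\lambda_j$, $j=1,\dots,m$, of $\overline{A}$), and assume $\gamma<1$. Let $N$ be a positive integer. Then for every $z\in\mathbb{C}$ with $|z|=1$, $$\left\| \left(I_m-z^{-1}\overline{A}\right)^{-1}-\prod_{n=0}^{N}\left(I_m+\left(z^{-1}\overline{A}\right)^{2^{n}}\right)\right\| \le \frac{\|\overline{A}\|^{2^{N+1}}}{1-\|\overline{A}\|}=\frac{\gamma^{2^{N+1}}}{1-\gamma},$$ and, as a result, for every $z\in\mathbb{C}$ with $|z|=1$, $$\left\| H(z)-H_N(z)\right\| \le \frac{\gamma^{2^{N+1}}}{1-\gamma}\,\|C\|\,\|\overline{B}\|,$$ where $$H(z)=C\left(I_m-z^{-1}\overline{A}\right)^{-1}\overline{B}+D,\qquad H_N(z)=C\prod_{n=0}^{N}\left(I_m+\left(z^{-1}\overline{A}\right)^{2^{n}}\right)\overline{B}+D.$$ In particular, any prescribed accuracy can be achieved by taking $N$ large enough: for every $\varepsilon>0$ there is a positive integer $N_0$ such that $\|H(z)-H_N(z)\|\le\varepsilon$ for all $N\ge N_0$ and all $z\in\mathbb{C}$ with $|z|=1$.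
   Context: $I_m$ is the $m\times m$ identity matrix, and $\|\cdot\|$ denotes the spectral norm of a matrix (operator norm induced by the Euclidean norms, i.e. the largest singular value). The function $H$ is the transfer function (in the z-transform domain) of the discrete linear time invariant system $\mathbf{x}_n=\overline{A}\mathbf{x}_{n-1}+\overline{B}\mathbf{u}_n$, $\mathbf{y}_n=C\mathbf{x}_n+D\mathbf{u}_n$ with $\mathbf{x}_{-1}=\mathbf{0}$, and $H_N$ is its approximation by a matrix polynomial in $z^{-1}$ of degree at most $2^{N+1}-1$. *)

(* Defs.v *)
From mathcomp Require Import all_boot all_order all_algebra.
From mathcomp Require Import spectral complex.
From mathcomp Require Import boolp classical_sets reals.

Set Implicit Arguments.
Unset Strict Implicit.
Unset Printing Implicit Defensive.

Import Order.TTheory GRing.Theory Num.Theory.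

Local Open Scope ring_scope.
Local Open Scope classical_set_scope.
Local Open Scope complex_scope.
Local Open Scope sesquilinear_scope.

(* The complex numbers are [R[i]] for an arbitrary
   [R : realType].  The modulus is [normc], which takes values in [R], rather
   than the generic norm, which takes values in [R[i]]. *)
Notation cmod := ComplexField.Normc.normc.

Definition l2norm (R : realType) (n : nat) (x : 'cV[R[i]]_n) : R :=
  Num.sqrt (\sum_i cmod (x i 0) ^+ 2).

(* Operator norm induced by [l2norm].  The supremum is over the closed unit
   ball, which, unlike the unit sphere, is nonempty also for [n = 0]. *)
Definition spectral_norm (R : realType) (m n : nat) (A : 'M[R[i]]_(m, n)) : R :=
  sup [set l2norm (A *m x) | x in [set x : 'cV[R[i]]_n | l2norm x <= 1]].

(* Square roots of the eigenvalues of A^* A.  [eigenvalue] refers to row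
   eigenvectors, which give the same spectrum as column eigenvectors. *)
Definition singular_value (R : realType) (m : nat) (A : 'M[R[i]]_m) (s : R)
  : Prop := 0 <= s /\ eigenvalue (A ^t* *m A) (s ^+ 2)%:C.

Definition largest_singular_value (R : realType) (m : nat) (A : 'M[R[i]]_m)
    (s : R) : Prop :=
  singular_value A s /\ forall t : R, singular_value A t -> t <= s.

(* Transfer function of x_n = A x_{n-1} + B u_n, y_n = C x_n + D u_n,
   x_{-1} = 0.  Since [invmx] is total, it is only meaningful where
   [1%:M - z^-1 *: A] is invertible. *)
Definition transfer (R : realType) (m p q : nat) (A : 'M[R[i]]_m)
    (B : 'M[R[i]]_(m, p)) (C : 'M[R[i]]_(q, m)) (D : 'M[R[i]]_(q, p))
    (z : R[i]) : 'M[R[i]]_(q, p) :=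
  C *m invmx (1%:M - z^-1 *: A) *m B + D.

Definition transfer_approx (R : realType) (m p q : nat) (A : 'M[R[i]]_m)
    (B : 'M[R[i]]_(m, p)) (C : 'M[R[i]]_(q, m)) (D : 'M[R[i]]_(q, p))
    (N : nat) (z : R[i]) : 'M[R[i]]_(q, p) :=
  C *m (\prod_(0 <= n < N.+1) (1%:M + (z^-1 *: A) ^+ (2 ^ n))) *m B + D.

(* Main.v *)
Require Import Defs.
From mathcomp Require Import all_boot all_order all_algebra.
From mathcomp Require Import spectral complex.
From mathcomp Require Import boolp classical_sets reals.
From mathcomp Require Import ring.

(** The argument rests on two facts about the operator norm.

    First, the operator norm of [A] is its largest singular value
    ([spectral_norm_singular]): diagonalizing the Hermitian matrix [A^* A] in a
    unitary basis turns [|A x|^2] into a weighted sum of squares with weights at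
    most [gamma ^+ 2], with equality at an eigenvector.  Eigenvalues are bounded
    by the operator norm, by applying [A] to an eigenvector
    ([eigenvalue_le_spectral_norm]).

    Second, put [X = z^-1 *: A]; since [z] has modulus one, [X] has the same norm
    [gamma < 1] as [A].  The triangle inequality gives
    [(1 - gamma) |x| <= |(1 - X) x|] ([l2norm_le_1Bmx]), so [1 - X] is invertible.
    The product of the [1 + X ^+ (2 ^ n)] telescopes against [1 - X]
    ([prod_1D_exp2]), so the truncation error [E] satisfies
    [(1 - X) E = X ^+ (2 ^ N.+1)]; the same inequality applied to [E y] yields
    [|E| <= gamma ^+ (2 ^ N.+1) / (1 - gamma)] ([neumann_product_error]).

    The bound on the transfer functions follows by submultiplicativity, since the
    terms [D] cancel ([transfer_error]), and it tends to [0] as [N] grows because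
    [k * (1 - gamma) * gamma ^+ k <= 1] ([exp2_error_small]). *)

Set Implicit Arguments.
Unset Strict Implicit.
Unset Printing Implicit Defensive.

Import Order.TTheory GRing.Theory Num.Theory.

Local Open Scope ring_scope.

(** * Euclidean norm on complex column vectors *)

Section EuclideanNorm.
Local Open Scope complex_scope.
Local Open Scope sesquilinear_scope.

Variable R : realType.
Implicit Types n : nat.

Lemma cmod_ge0 (a : R[i]) : 0 <= cmod a.
Proof. by case: a => a b; apply: sqrtr_ge0. Qed.

Lemma l2norm_ge0 n (x : 'cV[R[i]]_n) : 0 <= l2norm x.
Proof. exact: sqrtr_ge0. Qed.

Lemma sqr_l2norm n (x : 'cV[R[i]]_n) :
  l2norm x ^+ 2 = \sum_i cmod (x i 0) ^+ 2.
Proof. by rewrite sqr_sqrtr // sumr_ge0 // => i _; rewrite sqr_ge0. Qed.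

Lemma conj_mul_cmod (a : R[i]) : a^*%R * a = (cmod a ^+ 2)%:C.
Proof. by rewrite mulrC -normCK rmorphXn. Qed.

Lemma sqr_l2normE n (x : 'cV[R[i]]_n) :
  (l2norm x ^+ 2)%:C = (x ^t* *m x) 0 0.
Proof.
rewrite sqr_l2norm rmorph_sum mxE; apply: eq_bigr => i _.
by rewrite !mxE conj_mul_cmod.
Qed.

Lemma l2norm_eq0 n (x : 'cV[R[i]]_n) : (l2norm x == 0) = (x == 0).
Proof.
apply/idP/eqP => [/eqP x0|->]; last first.
  rewrite /l2norm big1 ?sqrtr0 // => i _.
  by rewrite mxE ComplexField.Normc.normc0 expr0n.
have s0 : \sum_i cmod (x i 0) ^+ 2 = 0 by rewrite -sqr_l2norm x0 expr0n.
apply/matrixP => i j; rewrite ord1 mxE.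
apply: ComplexField.Normc.eq0_normc; apply/eqP; rewrite -sqrf_eq0.
by move/psumr_eq0P: s0 => -> // k _; rewrite sqr_ge0.
Qed.

Lemma l2norm0 n : l2norm (0 : 'cV[R[i]]_n) = 0.
Proof. by apply/eqP; rewrite l2norm_eq0. Qed.

Lemma l2norm_gt0 n (x : 'cV[R[i]]_n) : (0 < l2norm x) = (x != 0).
Proof. by rewrite lt_def l2norm_eq0 l2norm_ge0 andbT. Qed.

Lemma l2normZ n (a : R[i]) (x : 'cV[R[i]]_n) :
  l2norm (a *: x) = cmod a * l2norm x.
Proof.
rewrite /l2norm -[cmod a]ger0_norm ?cmod_ge0 // -sqrtr_sqr.
rewrite -sqrtrM ?sqr_ge0 // mulr_sumr; congr Num.sqrt; apply: eq_bigr => i _.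
by rewrite mxE ComplexField.Normc.normcM exprMn.
Qed.

(** Identifies [l2norm] with the norm of the standard Hermitian product on row
    vectors, whose triangle inequality is then available. *)
Lemma sqrtC_dotmx_tr n (x : 'cV[R[i]]_n) :
  sqrtC (dotmx x^T x^T) = (l2norm x)%:C.
Proof.
rewrite -[RHS]sqrCK ?ler0c ?l2norm_ge0 // -rmorphXn sqr_l2norm rmorph_sum.
congr sqrtC; rewrite dotmxE mxE; apply: eq_bigr => i _.
by rewrite !mxE mulrC conj_mul_cmod.
Qed.

Lemma l2normD n (x y : 'cV[R[i]]_n) : l2norm (x + y) <= l2norm x + l2norm y.
Proof.
rewrite -lecR rmorphD /= -!sqrtC_dotmx_tr linearD /=.
exact: (triangle_lerif (@dotmx R[i] n) x^T y^T).1.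
Qed.

Lemma l2norm_sum n k (F : 'I_k -> 'cV[R[i]]_n) :
  l2norm (\sum_j F j) <= \sum_j l2norm (F j).
Proof.
elim/big_ind2: _ => [|x a y b xa yb|//]; first by rewrite l2norm0.
by apply: le_trans (l2normD _ _) _; apply: lerD.
Qed.

Lemma cmod_le_l2norm n (x : 'cV[R[i]]_n) i : cmod (x i 0) <= l2norm x.
Proof.
rewrite -ler_sqr ?nnegrE ?cmod_ge0 ?l2norm_ge0 // sqr_l2norm (bigD1 i) //=.
by rewrite lerDl sumr_ge0 // => j _; rewrite sqr_ge0.
Qed.

End EuclideanNorm.

(** * Operator norm *)

Section SpectralNorm.
Local Open Scope classical_set_scope.
Local Open Scope complex_scope.

Variable R : realType.

(** A crude bound, obtained by expanding [A *m x] on the columns of [A]; it only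
    serves to show that the supremum defining [spectral_norm] is finite. *)
Lemma l2norm_mulmx_cols m n (A : 'M[R[i]]_(m, n)) x :
  l2norm (A *m x) <= (\sum_j l2norm (col j A)) * l2norm x.
Proof.
have -> : A *m x = \sum_j x j 0 *: col j A.
  apply/matrixP => i k; rewrite ord1 mxE summxE; apply: eq_bigr => j _.
  by rewrite !mxE mulrC.
apply: le_trans (l2norm_sum _) _; rewrite mulr_suml; apply: ler_sum => j _.
by rewrite l2normZ mulrC ler_wpM2l ?l2norm_ge0 ?cmod_le_l2norm.
Qed.

Lemma spectral_norm_has_ub m n (A : 'M[R[i]]_(m, n)) :
  has_ubound [set l2norm (A *m x) | x in [set x : 'cV[R[i]]_n | l2norm x <= 1]].
Proof.
exists (\sum_j l2norm (col j A)) => _ [y /= y1 <-].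
apply: le_trans (l2norm_mulmx_cols _ _) _.
by rewrite -[leRHS]mulr1 ler_wpM2l // sumr_ge0 // => j _; apply: l2norm_ge0.
Qed.

Lemma spectral_norm_ge0 m n (A : 'M[R[i]]_(m, n)) : 0 <= spectral_norm A.
Proof.
apply: ub_le_sup; first exact: spectral_norm_has_ub.
by exists 0; rewrite /= ?mulmx0 l2norm0.
Qed.

(** Together with [spectral_norm_le], this characterizes the supremum
    [spectral_norm A] as the least constant [c >= 0] with [|A x| <= c |x|] for
    all [x].  The supremum runs over the unit ball, hence the rescaling of [x]. *)
Lemma l2norm_mulmx m n (A : 'M[R[i]]_(m, n)) x :
  l2norm (A *m x) <= spectral_norm A * l2norm x.
Proof.
have [->|x0] := eqVneq x 0; first by rewrite mulmx0 !l2norm0 mulr0.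
have xgt0 : 0 < l2norm x by rewrite l2norm_gt0.
have xV (k : nat) (y : 'cV[R[i]]_k) :
    l2norm ((l2norm x)^-1%:C *: y) = (l2norm x)^-1 * l2norm y.
  rewrite l2normZ; congr (_ * _).
  by rewrite /= expr0n addr0 sqrtr_sqr ger0_norm ?invr_ge0 ?l2norm_ge0.
rewrite -ler_pdivrMr // mulrC -xV scalemxAr.
apply: ub_le_sup; first exact: spectral_norm_has_ub.
by exists ((l2norm x)^-1%:C *: x); rewrite //= xV mulVf // gt_eqF.
Qed.

Lemma spectral_norm_le m n (A : 'M[R[i]]_(m, n)) c :
  0 <= c -> (forall x, l2norm (A *m x) <= c * l2norm x) -> spectral_norm A <= c.
Proof.
move=> c0 Ac; apply: ge_sup.
  by exists (l2norm (A *m 0)), 0; rewrite //= l2norm0.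
move=> _ [x /= x1 <-]; apply: le_trans (Ac x) _.
by rewrite -[leRHS]mulr1 ler_wpM2l.
Qed.

Lemma spectral_normM m n k (A : 'M[R[i]]_(m, n)) (B : 'M[R[i]]_(n, k)) :
  spectral_norm (A *m B) <= spectral_norm A * spectral_norm B.
Proof.
apply: spectral_norm_le => [|x]; first by rewrite mulr_ge0 ?spectral_norm_ge0.
rewrite -mulmxA -mulrA; apply: le_trans (l2norm_mulmx _ _) _.
by rewrite ler_wpM2l ?spectral_norm_ge0 ?l2norm_mulmx.
Qed.

Lemma spectral_normZ_unimodular m n (a : R[i]) (A : 'M[R[i]]_(m, n)) :
  cmod a = 1 -> spectral_norm (a *: A) = spectral_norm A.
Proof.
move=> a1; congr sup; apply: eq_imagel => x _.
by rewrite -scalemxAl l2normZ a1 mul1r.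
Qed.

Lemma l2norm_expmx n (X : 'M[R[i]]_n) k x :
  l2norm (X ^+ k *m x) <= spectral_norm X ^+ k * l2norm x.
Proof.
elim: k => [|k IH]; first by rewrite !expr0 mul1mx mul1r.
rewrite !exprS -mulmxE -mulmxA -mulrA; apply: le_trans (l2norm_mulmx _ _) _.
by rewrite ler_wpM2l ?spectral_norm_ge0.
Qed.

End SpectralNorm.

(** * Column vectors in kernels and eigenspaces *)

Section KernelVectors.
Variable F : fieldType.

(** [row_free] speaks of row kernels, whereas operator norms act on columns;
    transposition passes from one to the other. *)
Lemma unitmx_ker0 n (M : 'M[F]_n) :
  (forall x : 'cV_n, M *m x = 0 -> x = 0) -> M \in unitmx.
Proof.
move=> ker0; rewrite -unitmx_tr -row_free_unit; apply: inj_row_free => v vM.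
apply: trmx_inj; rewrite trmx0; apply: ker0.
by rewrite -[M]trmxK -trmx_mul vM trmx0.
Qed.

Lemma eigenvalue_col_eigenvector n (M : 'M[F]_n) a :
  eigenvalue M a -> exists2 x : 'cV_n, x != 0 & M *m x = a *: x.
Proof.
move=> aM; apply: contrapT => nox.
suff Ma : M - a%:M \in unitmx.
  by move: aM; rewrite /eigenvalue /eigenspace kermx_eq0 row_free_unit Ma.
apply: unitmx_ker0 => x Mx; apply: contrapT => x0; apply: nox.
exists x; first exact/eqP.
by apply/eqP; rewrite -subr_eq0 -mul_scalar_mx -mulmxBl Mx.
Qed.

End KernelVectors.

(** * Singular values *)

Section SingularValues.
Local Open Scope complex_scope.
Local Open Scope sesquilinear_scope.

Variable R : realType.

(** If [v] is a row eigenvector of the Gram matrix for [a], then [x = v^*]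
    satisfies [|A x|^2 = v A^* A v^* = a v v^* = a |x|^2]. *)
Lemma gram_eigenvector m n (A : 'M[R[i]]_(m, n)) a :
  eigenvalue (A ^t* *m A) a -> exists2 x : 'cV_n, x != 0 &
    (l2norm (A *m x) ^+ 2)%:C = a * (l2norm x ^+ 2)%:C.
Proof.
case/eigenvalueP=> v vA v0; exists (v ^t*).
  by rewrite map_mx_eq0 trmx_eq0.
rewrite !sqr_l2normE trmx_mul map_mxM trmxCK /= mulmxA -(mulmxA v) vA.
by rewrite -scalemxAl mxE.
Qed.

(** By [gram_eigenvector], [a] is the square of the real ratio [|A x| / |x|], so
    it comes from a singular value in the real sense. *)
Lemma gram_eigenvalue m (A : 'M[R[i]]_m) a :
  eigenvalue (A ^t* *m A) a -> exists2 s, singular_value A s & a = (s ^+ 2)%:C.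
Proof.
move=> aA; have [x x0 Ax] := gram_eigenvector aA.
have aE : a = ((l2norm (A *m x) / l2norm x) ^+ 2)%:C.
  rewrite expr_div_n rmorphM /= Ax fmorphV /= mulfK //.
  by rewrite fmorph_eq0 expf_neq0 // l2norm_eq0.
exists (l2norm (A *m x) / l2norm x); last exact: aE.
by split; [rewrite divr_ge0 ?l2norm_ge0 | rewrite -aE].
Qed.

(** The Gram matrix is Hermitian, so [A^* A = P^* diag(d) P] with [P] unitary.
    Each [d_i] is the square of a singular value, hence at most [g^2], and with
    [y = P x] one gets [|A x|^2 = sum_i d_i |y_i|^2 <= g^2 |y|^2 = g^2 |x|^2]. *)
Lemma l2norm_mulmx_singular m (A : 'M[R[i]]_m) g x :
  0 <= g -> (forall s, singular_value A s -> s <= g) ->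
  l2norm (A *m x) <= g * l2norm x.
Proof.
move=> g0 gA; pose M := A ^t* *m A.
have MH : M ^t* = M by rewrite trmx_mul map_mxM trmxCK.
have /orthomx_spectralP : M \is normalmx by apply/normalmxP; rewrite MH.
set P := spectralmx M; set d := spectral_diag M.
have PU : P \is unitarymx := spectral_unitarymx M.
rewrite invmx_unitary // => MP.
have PtP : P ^t* *m P = 1%:M.
  by rewrite -(invmx_unitary PU) mulVmx // unitarymx_unit.
pose y := P *m x.
have normy : l2norm y = l2norm x.
  apply/eqP; rewrite -(@eqrXn2 _ 2) ?l2norm_ge0 //; apply/eqP/complexI.
  rewrite !sqr_l2normE trmx_mul map_mxM mulmxA -(mulmxA _ _ P).
  by rewrite PtP mulmx1.
have dP i : exists2 s, singular_value A s & d 0 i = (s ^+ 2)%:C.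
  apply: gram_eigenvalue; apply/eigenvalueP; exists (row i P); last first.
    apply/eqP => Pi0; have /eqP := row_unitarymxP PU i i.
    by rewrite Pi0 eqxx dotmxE mul0mx mxE eq_sym oner_eq0.
  rewrite -row_mul -/M MP !mulmxA (unitarymxP _) // mul1mx.
  by rewrite row_mul row_diag_mx -scalemxAl -rowE.
(* In the coordinates [y] both sides are diagonal quadratic forms, which are
   compared term by term. *)
have le2 : l2norm (A *m x) ^+ 2 <= g ^+ 2 * l2norm y ^+ 2.
  rewrite -lecR [X in X <= _]sqr_l2normE.
  have -> : (A *m x) ^t* *m (A *m x) = y ^t* *m diag_mx d *m y.
    by rewrite !trmx_mul !map_mxM /= -!mulmxA (mulmxA (A ^t* )) -/M MP !mulmxA.
  rewrite mxE sqr_l2norm rmorphM rmorph_sum mulr_sumr /=.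
  apply: ler_sum => i _.
  have [s [s0 sv] ds] := dP i.
  rewrite mul_mx_diag !mxE mulrAC conj_mul_cmod ds -!rmorphM lecR mulrC.
  by rewrite ler_wpM2r ?sqr_ge0 // ler_sqr ?nnegrE // gA.
by rewrite -ler_sqr ?nnegrE ?mulr_ge0 ?l2norm_ge0 // exprMn -normy.
Qed.

(** The diagonalization gives the upper bound; an eigenvector of the Gram matrix
    for [g ^+ 2] attains it. *)
Lemma spectral_norm_singular m (A : 'M[R[i]]_m) g :
  largest_singular_value A g -> spectral_norm A = g.
Proof.
case=> -[g0 gA] gmax; apply/eqP; rewrite eq_le; apply/andP; split.
  by apply: spectral_norm_le => // x; apply: l2norm_mulmx_singular.
have [x x0] := gram_eigenvector gA; rewrite -rmorphM => /complexI Ax.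
rewrite -(ler_pM2r (_ : 0 < l2norm x)) ?l2norm_gt0 //.
apply: le_trans (l2norm_mulmx _ _).
by rewrite -ler_sqr ?nnegrE ?mulr_ge0 ?l2norm_ge0 // Ax exprMn.
Qed.

Lemma eigenvalue_le_spectral_norm m (A : 'M[R[i]]_m) a :
  eigenvalue A a -> cmod a <= spectral_norm A.
Proof.
case/eigenvalue_col_eigenvector=> x x0 Ax.
rewrite -(ler_pM2r (_ : 0 < l2norm x)) ?l2norm_gt0 //.
by rewrite -l2normZ -Ax l2norm_mulmx.
Qed.

End SingularValues.

(** * Factored Neumann series *)

Section NeumannSeries.

(** Each factor squares the power in [(1 - Y) * (1 + Y) = 1 - Y ^+ 2], starting
    from [Y = X]. *)
Lemma prod_1D_exp2 (S : pzRingType) (X : S) k :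
  (1 - X) * \prod_(0 <= n < k) (1 + X ^+ (2 ^ n)) = 1 - X ^+ (2 ^ k).
Proof.
elim: k => [|k IH]; first by rewrite big_geq // mulr1 expr1.
rewrite big_nat_recr //= mulrA IH mulrDr mulr1 mulrBl mul1r -exprD.
by rewrite addnn -mul2n -expnS addrA subrK.
Qed.

Variable R : realType.

(** This single lower bound gives both the invertibility of [1 - X] and the
    factor [1 / (1 - |X|)] in the truncation error, which
    is thus obtained without summing a series. *)
Lemma l2norm_le_1Bmx n (X : 'M[R[i]]_n) x :
  (1 - spectral_norm X) * l2norm x <= l2norm ((1%:M - X) *m x).
Proof.
rewrite mulrBl mul1r lerBlDr mulmxBl mul1mx.
rewrite -{1}[x](subrK (X *m x)); apply: le_trans (l2normD _ _) _.
by rewrite lerD2l l2norm_mulmx.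
Qed.

Lemma unitmx_1B n (X : 'M[R[i]]_n) :
  spectral_norm X < 1 -> 1%:M - X \in unitmx.
Proof.
move=> X1; apply: unitmx_ker0 => x Xx.
have := l2norm_le_1Bmx X x; rewrite Xx l2norm0 pmulr_rle0 ?subr_gt0 // => x0.
by apply/eqP; rewrite -l2norm_eq0 eq_le x0 l2norm_ge0.
Qed.

(** Multiplying the error by [1 - X] leaves exactly [X ^+ (2 ^ k)], by
    telescoping; [l2norm_le_1Bmx] then removes the factor [1 - X]. *)
Lemma neumann_product_error n (X : 'M[R[i]]_n) k :
  spectral_norm X < 1 ->
  spectral_norm (invmx (1%:M - X)
      - \prod_(0 <= j < k) (1%:M + X ^+ (2 ^ j)))
    <= spectral_norm X ^+ (2 ^ k) / (1 - spectral_norm X).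
Proof.
move=> X1; have X1' : 0 < 1 - spectral_norm X by rewrite subr_gt0.
apply: spectral_norm_le => [|x].
  by rewrite divr_ge0 ?exprn_ge0 ?spectral_norm_ge0 // ltW.
rewrite mulrAC ler_pdivlMr // mulrC; apply: le_trans (l2norm_le_1Bmx _ _) _.
rewrite mulmxA mulmxBr mulmxV ?unitmx_1B //.
have -> : (1%:M - X) *m \prod_(0 <= j < k) (1%:M + X ^+ (2 ^ j))
    = 1%:M - X ^+ (2 ^ k) by exact: prod_1D_exp2.
by rewrite subKr l2norm_expmx.
Qed.

(** The geometric sum [(1 - g ^+ k) / (1 - g)] has [k] terms, each at least
    [g ^+ k]. *)
Lemma mul_1B_exprn_le1 (g : R) k : 0 <= g -> g <= 1 ->
  k%:R * (1 - g) * g ^+ k <= 1.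
Proof.
move=> g0 g1; rewrite mulrAC mulrC; apply: (@le_trans _ _ (1 - g ^+ k)); last first.
  by rewrite lerBlDr lerDl exprn_ge0.
rewrite -[1 - _ ^+ _]opprB subrX1 -mulNr opprB ler_wpM2l ?subr_ge0 //.
rewrite mulr_natl -[X in _ *+ X]card_ord -sumr_const; apply: ler_sum => i _.
by rewrite ler_wiXn2l // ltnW.
Qed.

End NeumannSeries.

(** * Transfer functions *)

Section TransferFunction.
Variable R : realType.

(** [mul_1B_exprn_le1] at [k = 2 ^ N.+1] makes the left-hand side at most
    [c / ((1 - g) ^+ 2 * 2 ^ N.+1)], so the Archimedean property suffices. *)
Lemma exp2_error_small (g c eps : R) : 0 <= g -> g < 1 -> 0 <= c -> 0 < eps ->
  exists N0 : nat, (0 < N0)%N /\ forall N, (N0 <= N)%N ->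
    g ^+ (2 ^ N.+1) / (1 - g) * c <= eps.
Proof.
move=> g0 g1 c0 e0; have g1' : 0 < 1 - g by rewrite subr_gt0.
pose b := c / ((1 - g) ^+ 2 * eps).
have b0 : 0 <= b by rewrite divr_ge0 // mulr_ge0 ?sqr_ge0 // ltW.
exists (Num.bound b).+1; split=> // N ltN.
set K := (2 ^ N.+1)%N.
have bK : b <= K%:R.
  apply: le_trans (ltW (archi_boundP b0)) _; rewrite ler_nat.
  apply: leq_trans (ltnW ltN) _; apply: ltnW; apply: leq_trans (ltnSn N) _.
  exact/ltnW/ltn_expl.
have K0 : 0 < K%:R :> R by rewrite ltr0n expn_gt0.
have gK : g ^+ K <= (K%:R * (1 - g))^-1.
  by rewrite -[leRHS]mul1r ler_pdivlMr ?mulr_gt0 // mulrC mul_1B_exprn_le1 // ltW.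
have cK : c <= K%:R * ((1 - g) ^+ 2 * eps).
  by rewrite -ler_pdivrMr // mulr_gt0 // exprn_gt0.
rewrite mulrAC ler_pdivrMr //.
apply: (@le_trans _ _ ((K%:R * (1 - g))^-1 * c)); first by rewrite ler_wpM2r.
rewrite mulrC ler_pdivrMr ?mulr_gt0 //.
have -> : eps * (1 - g) * (K%:R * (1 - g)) = K%:R * ((1 - g) ^+ 2 * eps).
  by ring.
exact: cK.
Qed.

Lemma transfer_error m p q (A : 'M[R[i]]_m) (B : 'M[R[i]]_(m, p))
    (C : 'M[R[i]]_(q, m)) (D : 'M[R[i]]_(q, p)) N z :
  spectral_norm A < 1 -> cmod z = 1 ->
  spectral_norm (transfer A B C D z - transfer_approx A B C D N z)
    <= spectral_norm A ^+ (2 ^ N.+1) / (1 - spectral_norm A)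
       * spectral_norm C * spectral_norm B.
Proof.
move=> A1 z1; rewrite /transfer /transfer_approx opprD addrACA subrr addr0.
rewrite -mulmxBl -mulmxBr.
apply: le_trans (spectral_normM _ _) _; rewrite ler_wpM2r ?spectral_norm_ge0 //.
apply: le_trans (spectral_normM _ _) _.
rewrite [leRHS]mulrC ler_wpM2l ?spectral_norm_ge0 //.
have zA : spectral_norm (z^-1 *: A) = spectral_norm A.
  by rewrite spectral_normZ_unimodular // ComplexField.Normc.normcV z1 invr1.
by rewrite -zA; apply: neumann_product_error; rewrite zA.
Qed.

End TransferFunction.

(** * Approximation on the unit circle *)

Theorem lemma1 (R : realType) (m p q : nat)
    (hp : (1 <= p <= m)%N) (hq : (1 <= q <= m)%N)
    (A : 'M[R[i]]_m) (B : 'M[R[i]]_(m, p))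
    (C : 'M[R[i]]_(q, m)) (D : 'M[R[i]]_(q, p))
    (gamma : R) (hgamma : largest_singular_value A gamma)
    (hgamma1 : gamma < 1) :
  [/\ gamma = spectral_norm A
        /\ (forall lambda : R[i], eigenvalue A lambda -> cmod lambda <= gamma),
      forall z : R[i], cmod z = 1 -> 1%:M - z^-1 *: A \in unitmx,
      forall N : nat, (0 < N)%N -> forall z : R[i], cmod z = 1 ->
        spectral_norm (invmx (1%:M - z^-1 *: A)
            - \prod_(0 <= n < N.+1) (1%:M + (z^-1 *: A) ^+ (2 ^ n)))
          <= spectral_norm A ^+ (2 ^ N.+1) / (1 - spectral_norm A)
        /\ spectral_norm A ^+ (2 ^ N.+1) / (1 - spectral_norm A)
            = gamma ^+ (2 ^ N.+1) / (1 - gamma),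
      forall N : nat, (0 < N)%N -> forall z : R[i], cmod z = 1 ->
        spectral_norm (transfer A B C D z - transfer_approx A B C D N z)
          <= gamma ^+ (2 ^ N.+1) / (1 - gamma)
             * spectral_norm C * spectral_norm B
    & forall eps : R, 0 < eps -> exists N0 : nat, (0 < N0)%N /\
        forall N : nat, (N0 <= N)%N -> forall z : R[i], cmod z = 1 ->
          spectral_norm (transfer A B C D z - transfer_approx A B C D N z)
            <= eps].
Proof.
have gE := spectral_norm_singular hgamma.
have g0 : 0 <= gamma by case: hgamma => -[].
have zA (z : R[i]) : cmod z = 1 -> spectral_norm (z^-1 *: A) = gamma.
  move=> z1; rewrite spectral_normZ_unimodular //.
  by rewrite ComplexField.Normc.normcV z1 invr1.
have HN N z : cmod z = 1 ->
    spectral_norm (transfer A B C D z - transfer_approx A B C D N z)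
      <= gamma ^+ (2 ^ N.+1) / (1 - gamma) * spectral_norm C * spectral_norm B.
  by move=> z1; rewrite -gE; apply: transfer_error; rewrite ?gE.
split.
- by split=> // lambda; rewrite -gE; apply: eigenvalue_le_spectral_norm.
- by move=> z z1; apply: unitmx_1B; rewrite zA.
- move=> N _ z z1; rewrite gE; split=> //.
  rewrite -[X in _ <= X ^+ _ / (1 - X)](zA z z1).
  by apply: neumann_product_error; rewrite zA.
- by move=> N _; apply: HN.
move=> eps e0.
have c0 : 0 <= spectral_norm C * spectral_norm B.
  by rewrite mulr_ge0 ?spectral_norm_ge0.
have [N0 [N0gt0 small]] := exp2_error_small g0 hgamma1 c0 e0.
exists N0; split=> // N leN z z1; apply: le_trans (HN N z z1) _.
by rewrite -mulrA small.
Qed.
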